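(* For every $2$-coloring of the edges of the complete graph on the vertex set $\{\pm1\}^{78}$, there exist a vertex $u$ and four distinct coordinates $i,j,k,l \in \{1,\dots,78\}$ such that the four edges $\{u, u\oplus i\oplus j\}$, $\{u\oplus i \oplus j, u\oplus i\oplus j\oplus k\oplus l\}$, $\{u\oplus k\oplus l, u\oplus i\oplus j\oplus k\oplus l\}$, $\{u, u\oplus k\oplus l\}$ all have the same color (i.e., there is a monochromatic planar square whose sides have Hamming length $2$).
   Context: For a vertex $v \in \{\pm1\}^n$ and $1\le i\le n$, $v \oplus i$ denotes the vertex obtained from $v$ by flipping the sign of the $i$-th coordinate. Hamming length of an edge is the number of coordinates in which its endpoints differ. Only the four sides of the square are required to be monochromatic, not its diagonals. *)

(* Defs.v *)
From mathcomp Require Import all_boot.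

Set Implicit Arguments.
Unset Strict Implicit.
Unset Printing Implicit Defensive.

(* The vertex set {+1, -1}^n, where the boolean b stands for the sign (-1)^b. *)
Definition cube (n : nat) := {ffun 'I_n -> bool}.

(* Flipping the sign of a coordinate is negating the boolean. *)
Definition flip (n : nat) (v : cube n) (i : 'I_n) : cube n :=
  [ffun j => if j == i then ~~ v j else v j].

Declare Scope cube_scope.
Notation "v ⊕ i" := (flip v i) (at level 50, left associativity) : cube_scope.

(* The edge joining distinct vertices u and v of the complete graph on V is
   the two-element set [set u; v]. A coloring is total on {set V}; its values
   on sets that are not edges are arbitrary and unused. *)
Definition edge_coloring2 (V : finType) := {set V} -> bool.

(* Main.v *)
(** Suppose that no square is monochromatic. Call a square good if its opposite
    sides have equal colors; a good square is then alternating, so the product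
    of the signs of two adjacent sides is -1 at each of its four corners, while
    for any other square the four corner products add up to 0. The proportion
    of good squares is bounded in two incompatible ways, by averaging over all
    vertices and all permutations of the coordinates.
    - Split the coordinates into 39 pairs. The square of the sum of the 39 signs
      of the edges leaving a vertex along these pairs is nonnegative, hence the
      average corner product is at least -1/38, and the proportion of good
      squares is at most 1/38.
    - Split the coordinates into 3 + 75. Flipping one coordinate in each part
      gives a 3 x 75 grid of vertices. Each of the 75 triangles has one of 8
      colorings, and two triangles with the same coloring span a good square,
      since two of the three edges joining them have the same color. Hence the
      proportion of good squares is at least (75/8 - 1)/(3 * 74) > 1/38. *)
Require Import Defs.
From mathcomp Require Import all_boot.
From mathcomp Require Import all_order all_algebra all_fingroup.
From mathcomp Require Import zify ring.

Import Order.TTheory GRing.Theory Num.Theory.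

Local Open Scope cube_scope.

(** * Flips of coordinates *)

Lemma flipK (n : nat) (u : cube n) (i : 'I_n) : u ⊕ i ⊕ i = u.
Proof. by apply/ffunP => j; rewrite !ffunE; case: eqP => // _; rewrite negbK. Qed.

Lemma flipAC (n : nat) (u : cube n) (i j : 'I_n) : u ⊕ i ⊕ j = u ⊕ j ⊕ i.
Proof. by apply/ffunP => k; rewrite !ffunE; case: eqP; case: eqP. Qed.

Lemma flip_inj (n : nat) (i : 'I_n) : injective (fun u : cube n => u ⊕ i).
Proof. by apply: (can_inj (g := fun u => u ⊕ i)) => u; apply: flipK. Qed.

Lemma flip2K (n : nat) (u : cube n) (i j : 'I_n) : u ⊕ i ⊕ j ⊕ i ⊕ j = u.
Proof. by rewrite -(flipAC _ (u ⊕ i)) !flipK. Qed.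

Lemma flip2AC (n : nat) (u : cube n) (i j k l : 'I_n) :
  u ⊕ i ⊕ j ⊕ k ⊕ l = u ⊕ k ⊕ l ⊕ i ⊕ j.
Proof.
by rewrite (flipAC _ (u ⊕ i) j) (flipAC _ u i) (flipAC _ (u ⊕ k ⊕ i))
           (flipAC _ (u ⊕ k)).
Qed.

(** * Averages over permutations, and counting collisions *)

Lemma exists_perm_map (T : finType) (s t : seq T) :
  uniq s -> uniq t -> size s = size t -> exists p : {perm T}, map p s = t.
Proof.
elim: s t => [|x s IHs] [|y t] //=; first by exists 1%g.
move=> /andP[xs us] /andP[yt ut] [/IHs] /(_ us ut) [p def_t].
(* The transposition corrects the image of the head; it fixes the images of the tail, which avoid
   both [p x] and [y]. *)
exists (p * tperm (p x) y)%g; rewrite permM tpermL; congr (_ :: _).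
rewrite -def_t; apply/eq_in_map => z zs; rewrite permM tpermD //.
  by rewrite (inj_eq perm_inj); apply: contraNneq xs => ->.
by apply: contraNneq yt => ->; rewrite -def_t map_f.
Qed.

Local Open Scope ring_scope.

(** Permutations act transitively on quadruples of distinct points, so averages do not depend on the
    chosen coordinates. *)
Lemma sum_perm4 (T : finType) (V : nmodType) (F : T -> T -> T -> T -> V)
    (a b c d a' b' c' d' : T) :
  uniq [:: a; b; c; d] -> uniq [:: a'; b'; c'; d'] ->
  \sum_(s : {perm T}) F (s a) (s b) (s c) (s d) =
  \sum_(s : {perm T}) F (s a') (s b') (s c') (s d').
Proof.
move=> u1 u2; have [p [<- <- <- <-]] := exists_perm_map _ _ _ u1 u2 erefl.
rewrite (reindex_inj (mulgI p)) /=.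
by apply: eq_bigr => s _; rewrite !permM.
Qed.

(** Cauchy-Schwarz for the fibre sizes [m t] of [f] on [A], whose squares add up to the number of
    colliding pairs. *)
Lemma collisions (I T : finType) (A : {set I}) (f : I -> T) :
  (#|A|%:Z ^+ 2 <=
   #|T|%:Z * \sum_(i in A) \sum_(j in A) (f i == f j)%:Z)%R.
Proof.
pose m t : int := \sum_(i in A) (f i == t)%:Z.
have sum_m : \sum_t m t = #|A|%:Z.
  rewrite exchange_big /= -natz -sumr_const.
  apply: eq_bigr => i _; rewrite (bigD1 (f i)) //= eqxx big1 ?addr0 //.
  by move=> t /negPf; rewrite eq_sym => ->.
have sum_m2 : \sum_t m t ^+ 2 = \sum_(i in A) \sum_(j in A) (f i == f j)%:Z.
  under eq_bigr => t _ do rewrite expr2 big_distrlr /=.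
  rewrite exchange_big /=; apply: eq_bigr => i _.
  rewrite exchange_big /=; apply: eq_bigr => j _.
  rewrite (bigD1 (f i)) //= eqxx mul1r eq_sym big1 ?addr0 //.
  by move=> t /negPf; rewrite eq_sym => ->; rewrite mul0r.
rewrite -sum_m2; set a := #|A|%:Z; set b := #|T|%:Z.
have : 0 <= \sum_t (b * m t - a) ^+ 2 by apply: sumr_ge0 => t _; apply: sqr_ge0.
have -> : \sum_t (b * m t - a) ^+ 2 = b * (b * (\sum_t m t ^+ 2) - a ^+ 2).
  transitivity (\sum_t (b ^+ 2 * m t ^+ 2 + (- (2 * a * b) * m t + a ^+ 2))).
    by apply: eq_bigr => t _; ring.
  rewrite !big_split /= -!mulr_sumr sum_m sumr_const -/a -mulr_natl natz -/b.
  by ring.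
(* Dividing by [b] needs [T] nonempty; if [T] is empty, so is [A]. *)
have [T0 | Tgt0] := posnP #|T|; last by rewrite pmulr_rge0 ?subr_ge0.
have -> : a = 0; first rewrite /a -sum_m big1 // => t.
  by have := max_card (pred1 t); rewrite T0 card1.
by have -> : b = 0 by [rewrite /b T0]; rewrite !mul0r expr0n.
Qed.

(** * Corner products and the upper bound *)

Definition opp_sides_eq {n : nat} (c : edge_coloring2 (cube n))
    (u : cube n) (i j k l : 'I_n) : bool :=
  (c [set u; u ⊕ i ⊕ j] == c [set u ⊕ k ⊕ l; u ⊕ i ⊕ j ⊕ k ⊕ l]) &&
  (c [set u; u ⊕ k ⊕ l] == c [set u ⊕ i ⊕ j; u ⊕ i ⊕ j ⊕ k ⊕ l]).

Definition mono_square {n : nat} (c : edge_coloring2 (cube n))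
    (u : cube n) (i j k l : 'I_n) : bool :=
  opp_sides_eq c u i j k l && (c [set u; u ⊕ i ⊕ j] == c [set u; u ⊕ k ⊕ l]).

Definition edge_sign {n : nat} (c : edge_coloring2 (cube n))
    (u : cube n) (i j : 'I_n) : int := (-1) ^+ c [set u; u ⊕ i ⊕ j].

Lemma edge_sign_flip (n : nat) (c : edge_coloring2 (cube n)) u i j :
  edge_sign c (u ⊕ i ⊕ j) i j = edge_sign c u i j.
Proof. by rewrite /edge_sign flip2K setUC. Qed.

Lemma sum_corners (n : nat) (c : edge_coloring2 (cube n)) (i j k l : 'I_n) :
    (forall u, ~~ mono_square c u i j k l) ->
  \sum_u edge_sign c u i j * edge_sign c u k l =
  - \sum_u (opp_sides_eq c u i j k l)%:Z.
Proof.
move=> no_mono; set S := LHS.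
have reidx F : \sum_u F u = \sum_(u : cube n) F (u ⊕ i ⊕ j) :> int.
  by rewrite (reindex_inj (inj_comp (flip_inj n j) (flip_inj n i))).
have reidx' F : \sum_u F u = \sum_(u : cube n) F (u ⊕ k ⊕ l) :> int.
  by rewrite (reindex_inj (inj_comp (flip_inj n l) (flip_inj n k))).
have S1 : S = \sum_u edge_sign c u i j * edge_sign c (u ⊕ i ⊕ j) k l.
  by rewrite /S reidx; apply: eq_bigr => u _; rewrite edge_sign_flip.
have S2 : S = \sum_u edge_sign c (u ⊕ k ⊕ l) i j * edge_sign c u k l.
  by rewrite /S reidx'; apply: eq_bigr => u _; rewrite edge_sign_flip.
have S3 : S = \sum_u edge_sign c (u ⊕ k ⊕ l) i j * edge_sign c (u ⊕ i ⊕ j) k l.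
  rewrite S1 reidx'; apply: eq_bigr => u _.
  by rewrite flip2AC edge_sign_flip.
(* The four corner products add up to [(a + a') * (b + b')], where [a], [a'] and [b], [b'] are the
   signs of opposite sides: 0 unless the square is good, and then -4, as it is not monochromatic. *)
have : S + S + S + S = - \sum_u 4 * (opp_sides_eq c u i j k l)%:Z.
  rewrite {1}/S {1}S1 {1}S2 S3 -!big_split -sumrN /=; apply: eq_bigr => u _.
  have := no_mono u; rewrite /mono_square /opp_sides_eq /edge_sign.
  rewrite (flip2AC _ u k l i j).
  by do 4![case: (c _)].
rewrite -mulr_sumr; move: (\sum_u _) => A; clearbody S; lia.
Qed.

Lemma sum_diag_offdiag (I : finType) (A : {set I}) (a b : int) :
  \sum_(i in A) \sum_(j in A) (if i == j then a else b) =
  #|A|%:Z * (a + (#|A|%:Z - 1) * b).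
Proof.
have row i : i \in A ->
    \sum_(j in A) (if i == j then a else b) = a + (#|A|%:Z - 1) * b.
  move=> Ai; rewrite (bigD1 i) //= eqxx; congr (_ + _).
  rewrite (eq_bigr (fun=> b)) => [|j /andP[_ /negPf]]; last first.
    by rewrite eq_sym => ->.
  rewrite (eq_bigl (mem (A :\ i))) => [|j]; last by rewrite !inE andbC.
  by rewrite sumr_const -mulr_natl natz (cardsD1 i A) Ai PoszD addrC addKr.
by rewrite (eq_bigr _ row) sumr_const -[LHS]mulr_natl natz.
Qed.

(** Expand the square of the sum over [m] disjoint pairs: each diagonal term is 1, and each of the
    [m * (m - 1)] others sums to [E] by symmetry. *)
Lemma sum_corners_ge (n m : nat) (c : edge_coloring2 (cube n))
    (p q : 'I_m -> 'I_n) (i j k l : 'I_n) :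
    uniq [:: i; j; k; l] ->
    (forall s t, s != t -> uniq [:: p s; q s; p t; q t]) ->
  0 <= m%:Z * (#|{perm 'I_n}|%:Z * #|cube n|%:Z + (m%:Z - 1) *
    \sum_(s : {perm 'I_n}) \sum_u
       edge_sign c u (s i) (s j) * edge_sign c u (s k) (s l)).
Proof.
move=> uijkl upq; set E := \sum_s _.
pose X u (s : {perm 'I_n}) t := edge_sign c u (s (p t)) (s (q t)).
have : 0 <= \sum_s \sum_u (\sum_(t in [set: 'I_m]) X u s t) ^+ 2.
  by do 2![apply: sumr_ge0 => ? _]; apply: sqr_ge0.
suff -> : \sum_s \sum_u (\sum_(t in [set: 'I_m]) X u s t) ^+ 2 =
    \sum_(t in [set: 'I_m]) \sum_(t' in [set: 'I_m])
      (if t == t' then #|{perm 'I_n}|%:Z * #|cube n|%:Z else E).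
  by rewrite sum_diag_offdiag cardsT card_ord.
under eq_bigr => s _ do under eq_bigr => u _ do rewrite expr2 big_distrlr.
under eq_bigr => s _ do rewrite exchange_big.
rewrite exchange_big; apply: eq_bigr => t _ /=.
under eq_bigr => s _ do rewrite exchange_big.
rewrite exchange_big; apply: eq_bigr => t' _ /=.
case: eqP => [<- | /eqP tt'].
  under eq_bigr => s _ do under eq_bigr => u _ do
    rewrite /X /edge_sign -expr2 sqrr_sign.
  under eq_bigr do rewrite sumr_const.
  by rewrite sumr_const -mulrnA natz mulnC PoszM.
exact: (sum_perm4 _ _ (fun a b a' b' =>
  \sum_u edge_sign c u a b * edge_sign c u a' b') _ _ _ _ _ _ _ _ (upq _ _ tt')).
Qed.

(** * Triangles in a grid and the lower bound *)

Definition triangle_colors {n : nat} (c : edge_coloring2 (cube n))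
    (u : cube n) (a b d y : 'I_n) : bool * bool * bool :=
  (c [set u ⊕ a ⊕ y; u ⊕ b ⊕ y], c [set u ⊕ a ⊕ y; u ⊕ d ⊕ y],
   c [set u ⊕ b ⊕ y; u ⊕ d ⊕ y]).

Lemma opp_sides_eq_grid (n : nat) (c : edge_coloring2 (cube n)) u a b y z :
  opp_sides_eq c (u ⊕ a ⊕ y) a b y z =
  (c [set u ⊕ a ⊕ y; u ⊕ b ⊕ y] == c [set u ⊕ a ⊕ z; u ⊕ b ⊕ z]) &&
  (c [set u ⊕ a ⊕ y; u ⊕ a ⊕ z] == c [set u ⊕ b ⊕ y; u ⊕ b ⊕ z]).
Proof.
have E v d e : v ⊕ d ⊕ e ⊕ d = v ⊕ e by rewrite flipAC flipK.
by rewrite /opp_sides_eq !flipK !E (flipAC _ u y b).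
Qed.

Lemma triangle_colors_eq (n : nat) (c : edge_coloring2 (cube n)) u a b d y z :
    triangle_colors c u a b d y = triangle_colors c u a b d z ->
  [|| opp_sides_eq c (u ⊕ a ⊕ y) a b y z, opp_sides_eq c (u ⊕ a ⊕ y) a d y z
    | opp_sides_eq c (u ⊕ b ⊕ y) b d y z].
Proof.
rewrite !opp_sides_eq_grid => -[-> -> ->]; rewrite !eqxx /=.
by do 3![case: (c _)].
Qed.

Lemma sum_opp_sides_ge (n : nat) (c : edge_coloring2 (cube n))
    (A : {set 'I_n}) (a b d i j k l : 'I_n) :
    uniq [:: i; j; k; l] -> uniq [:: a; b; d] ->
    {in A, forall y, y \notin [:: a; b; d]} ->
  #|A|%:Z ^+ 2 * (#|{perm 'I_n}|%:Z * #|cube n|%:Z) <=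
  8 * (#|A|%:Z * (#|{perm 'I_n}|%:Z * #|cube n|%:Z + (#|A|%:Z - 1) *
    (3 * \sum_(s : {perm 'I_n}) \sum_u
           (opp_sides_eq c u (s i) (s j) (s k) (s l))%:Z))).
Proof.
move=> uijkl uabd notA; set N := _%:Z * _%:Z; set G := \sum_s _.
pose sq u (s : {perm 'I_n}) a b y z : int :=
  (opp_sides_eq c (u ⊕ s a ⊕ s y) (s a) (s b) (s y) (s z))%:Z.
have sum_sq a' b' y z : uniq [:: a'; b'; y; z] ->
    \sum_s \sum_u sq u s a' b' y z = G.
  move=> uq; have /= := sum_perm4 _ _ (fun i j k l => \sum_u
    (opp_sides_eq c u i j k l)%:Z) _ _ _ _ _ _ _ _ uq uijkl.
  (* The base vertex of [sq] is a translate of [u], which the sum over all [u] absorbs. *)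
  rewrite /G => <-.
  apply: eq_bigr => s _; rewrite [RHS](reindex_inj (inj_comp
    (flip_inj _ (s y)) (flip_inj _ (s a')))) /=.
  by [].
(* [R] dominates the collision indicator: off the diagonal, equal triangles give one of three good
   squares. *)
pose R u s y z := if y == z then 1 else sq u s a b y z + sq u s a d y z + sq u s b d y z.
have step u s : #|A|%:Z ^+ 2 <= 8 * \sum_(y in A) \sum_(z in A) R u s y z.
  have := collisions _ _ A (fun y => triangle_colors c u (s a) (s b) (s d) (s y)).
  rewrite !card_prod card_bool => /le_trans; apply.
  rewrite ler_pM2l //; apply: ler_sum => y _; apply: ler_sum => z _; rewrite /R.
  case: (y =P z) => [-> | _]; first by rewrite eqxx.
  case: eqP => [/triangle_colors_eq | _]; rewrite /sq; by do 3![case: opp_sides_eq].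
have -> : #|A|%:Z ^+ 2 * N = \sum_(s : {perm 'I_n}) \sum_(u : cube n) #|A|%:Z ^+ 2.
  by rewrite !sumr_const -mulrnA -mulr_natr natz mulnC PoszM.
have -> : #|A|%:Z * (N + (#|A|%:Z - 1) * (3 * G)) =
    \sum_s \sum_u \sum_(y in A) \sum_(z in A) R u s y z.
  rewrite -sum_diag_offdiag.
  under [RHS]eq_bigr => s _ do rewrite exchange_big.
  rewrite [RHS]exchange_big; apply: eq_bigr => y Ay /=.
  under [RHS]eq_bigr => s _ do rewrite exchange_big.
  rewrite [RHS]exchange_big; apply: eq_bigr => z Az /=; rewrite /R.
  case: eqP => [_ | /eqP yz].
    under eq_bigr do rewrite sumr_const.
    by rewrite sumr_const -mulrnA natz mulnC PoszM.
  have [uab uad ubd] : [/\ uniq [:: a; b; y; z], uniq [:: a; d; y; z]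
                         & uniq [:: b; d; y; z]].
    move: (notA _ Ay) (notA _ Az) uabd yz.
    rewrite /= !inE !negb_or !(eq_sym y) !(eq_sym z).
    by do ?[case: (_ == _)].
  transitivity (\sum_s \sum_u sq u s a b y z + \sum_s \sum_u sq u s a d y z
    + \sum_s \sum_u sq u s b d y z); last first.
    by rewrite -!big_split; apply: eq_bigr => s _; rewrite -!big_split.
  rewrite mulr_natl 2!mulrSr mulr1n.
  by congr (_ + _ + _); symmetry; apply: sum_sq.
rewrite !mulr_sumr; apply: ler_sum => s _; rewrite mulr_sumr.
by apply: ler_sum => u _; apply: step.
Qed.

(** * Contradiction in dimension 78 *)

Lemma exists_mono_square (c : edge_coloring2 (cube 78)) :
  exists (u : cube 78) (i j k l : 'I_78),
    uniq [:: i; j; k; l] /\ mono_square c u i j k l.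
Proof.
pose T := (cube 78 * ('I_78 * 'I_78 * ('I_78 * 'I_78)))%type.
case: (pickP (fun x : T => let: (u, ((i, j), (k, l))) := x in
    uniq [:: i; j; k; l] && mono_square c u i j k l)).
  move=> [u [[i j] [k l]]] /andP[uq mono].
  by exists u, i, j, k, l.
move=> none.
pose i : 'I_78 := inord 0; pose j : 'I_78 := inord 1.
pose k : 'I_78 := inord 2; pose l : 'I_78 := inord 3.
have uq : uniq [:: i; j; k; l].
  by rewrite -(map_inj_uniq val_inj) /= !inordK.
pose G := \sum_(s : {perm 'I_78}) \sum_u
  (opp_sides_eq c u (s i) (s j) (s k) (s l))%:Z.
have uijk : uniq [:: i; j; k].
  by move: uq; rewrite -[[:: _, _ & _]]/([:: i; j; k] ++ [:: l]) cat_uniq => /andP[].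
pose A := [set y | y \notin [:: i; j; k]].
have cardA : #|A| = 75.
  have := cardC (mem [:: i; j; k]); rewrite (card_uniqP uijk) card_ord cardsE.
  by rewrite /= !addSn => -[].
have notA : {in A, forall y, y \notin [:: i; j; k]} by move=> y; rewrite inE.
have := @sum_opp_sides_ge 78 c A _ _ _ _ _ _ _ uq uijk notA.
rewrite -/G cardA => lower.
(* The 39 pairs match each coordinate of the first half with its copy in the second. *)
have pairs (s t : 'I_39) : s != t ->
    uniq [:: @lshift 39 39 s; @rshift 39 39 s; @lshift 39 39 t; @rshift 39 39 t].
  rewrite /= !inE !eq_lrshift !eq_rlshift eq_lshift eq_rshift.
  by case: (s == t).
have := @sum_corners_ge 78 39 c (@lshift 39 39) (@rshift 39 39) _ _ _ _ uq pairs.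
have -> : \sum_(s : {perm 'I_78}) \sum_u
    edge_sign c u (s i) (s j) * edge_sign c u (s k) (s l) = - G.
  rewrite -sumrN; apply: eq_bigr => s _; apply: sum_corners => u.
  have us : uniq (map s [:: i; j; k; l]).
    by rewrite map_inj_uniq //; apply: perm_inj.
  apply: contraFN (none (u, ((s i, s j), (s k, s l)))) => mono.
  by apply/andP.
move=> upper.
have P_gt0 : (0 < #|{perm 'I_78}|)%N by apply/card_gt0P; exists 1%g.
have C_gt0 : (0 < #|{: cube 78}|)%N by apply/card_gt0P; exists [ffun=> true].
have : 0 < #|{perm 'I_78}|%:Z * #|cube 78|%:Z by rewrite mulr_gt0.
move: lower upper; set N := _%:Z * #|cube 78|%:Z; rewrite expr2.
(* The bounds reduce to [67 * N <= 1776 * G] and [38 * G <= N]; since 67 * 38 = 2546 > 1776, they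
   contradict [0 < N]. *)
by lia.
Qed.

Local Close Scope ring_scope.

Theorem theorem1p5 (c : edge_coloring2 (cube 78)) :
  exists (u : cube 78) (i j k l : 'I_78) (color : bool),
    uniq [:: i; j; k; l] /\
    [/\ c [set u; u ⊕ i ⊕ j] = color,
        c [set u ⊕ i ⊕ j; u ⊕ i ⊕ j ⊕ k ⊕ l] = color,
        c [set u ⊕ k ⊕ l; u ⊕ i ⊕ j ⊕ k ⊕ l] = color
      & c [set u; u ⊕ k ⊕ l] = color].
Proof.
have [u [i [j [k [l [uq]]]]]] := exists_mono_square c.
move=> /andP[/andP[/eqP ij /eqP kl] /eqP ijkl].
exists u, i, j, k, l, (c [set u; u ⊕ i ⊕ j]).
by split=> //; split; rewrite // -?ij -?kl.
Qed.
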